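(* Let $0<\lambda\leqslant1/6$ be real and let $r\geqslant 2$, $\ell\geqslant 1$, $m\geqslant 1$ be integers. If $\mathrm{FR}(r,\lceil\lambda\ell\rceil)<2m\ell$, then $p_\lambda(r,\ell,\ell,m)=0$; otherwise $$\frac{1}{\mathrm{CR}(r,\ell)^m}\prod_{i=1}^{m}\min\Bigl[\omega_i(r,\ell,m),\ \beta(r,\ell,m)\cdot\prod_{k=1}^{\ell_1}\min\bigl((2r-1)^{\lceil\lambda\ell\rceil},\ \alpha_{i,k}(r,\ell,m)\bigr)\Bigr]$$ is an upper bound for $p_\lambda(r,\ell,\ell,m)$, where $$\omega_i(r,\ell,m)=\mathrm{CR}(r,\ell)-4(i-1)\ell(r-1)(2r-1)^{\ell-\lceil\lambda\ell\rceil-1},$$ $$\beta(r,\ell,m)=\mathrm{FR}(r,\ell_2),$$ $$\alpha_{i,1}(r,\ell,m)=\mathrm{FR}(r,\lceil\lambda\ell\rceil)-2(i-1)\ell,$$ $$\alpha_{i,k}(r,\ell,m)=\mathrm{FR}(r,\lceil\lambda\ell\rceil)-2(i-1)\ell-2\bigl((k-2)\lceil\lambda\ell\rceil+\ell_2+1\bigr)$$ for each $i\geqslant1$, $k\geqslant2$, and $\ell=\ell_1\lceil\lambda\ell\rceil+\ell_2$ with $\ell_1,\ell_2\in\mathbb{N}$ and $0\leqslant\ell_2<\lceil\lambda\ell\rceil$.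
   Context: $\mathrm{FR}(r,k)=2r(2r-1)^{k-1}$ (for $k\geqslant1$ this is the number of freely reduced words of length $k$ in the free group of rank $r$; the formula is also used for $k=0$), and $\mathrm{CR}(r,k)=(2r-1)^k+1+(r-1)(1+(-1)^k)$ (for $k\geqslant1$, the number of cyclically reduced words of length $k$). $p_\lambda(r,\ell,\ell,m)$ denotes the probability that a presentation $\langle X\mid W\rangle$, chosen uniformly at random among all those with $|X|=r$, $|W|=m$ and $|w|=\ell$ for each $w\in W$, has property $C'(\lambda)$. Here $X$ is a fixed set with $r$ elements, and elements of the free group $F(X)$ are identified with freely reduced words over $X^{\pm1}$; $|w|$ is word length. A word is cyclically reduced if all its cyclic permutations are freely reduced. For $0\leqslant d<|w|$, $w_{\ll d}$ is the left cyclic permutation of $w$ by distance $d$. A presentation $\langle X\mid W\rangle$ with $m$ relators is given by an ordered list $W\in F(X)^m$ of cyclically reduced words, repetitions allowed, lists differing by a permutation being distinct; the uniform distribution is on such lists. The symmetric closure is $W^S=\{w_{\ll d},(w_{\ll d})^{-1}: w\in W,\ 0\leqslant d<|w|\}$. $W$ is minimal if there is no proper sublist $U$ with $U^S=W^S$. A cyclically reduced word $w$ is power-free if $|(w)^S|=2|w|$. $\langle X\mid W\rangle$ has property $C'(\lambda)$ if $W$ is minimal, each $w\in W$ is power-free, and for any two distinct words $u,w\in W^S$: if $u=pa$ and $w=pb$ with $p,a,b\in F(X)$, $|u|=|p|+|a|$, $|w|=|p|+|b|$, then $|p|<\lambda\cdot\min(|u|,|w|)$. *)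

(* Defs.v *)
From mathcomp Require Import all_boot all_order all_algebra.
From mathcomp Require Import boolp reals.

Set Implicit Arguments.
Unset Strict Implicit.
Unset Printing Implicit Defensive.

Import Order.TTheory GRing.Theory Num.Theory.

Section Words.
Variable X : finType.

(* (x, false) stands for the generator x and (x, true) for its inverse. *)
Definition letter : finType := (X * bool)%type.

Definition linv (x : letter) : letter := (x.1, ~~ x.2).

Definition freely_reduced (w : seq letter) : bool :=
  sorted (fun x y => y != linv x) w.

(* Elements of the free group F(X) are the freely reduced words; [fmul] and
   [finv] are the group operations on these representatives. *)
Definition push (x : letter) (w : seq letter) : seq letter :=
  if w is y :: w' then if y == linv x then w' else x :: w else [:: x].
Definition free_reduce (w : seq letter) : seq letter := foldr push [::] w.
Definition fmul (u v : seq letter) : seq letter := free_reduce (u ++ v).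
Definition finv (w : seq letter) : seq letter := rev (map linv w).

Definition cyclically_reduced (w : seq letter) : bool :=
  all (fun d => freely_reduced (rot d w)) (iota 0 (size w)).

(* The set W^S, listed possibly with repetitions. *)
Definition sym_closure (W : seq (seq letter)) : seq (seq letter) :=
  flatten [seq flatten [seq [:: rot d w; finv (rot d w)] | d <- iota 0 (size w)]
          | w <- W].

Definition minimal_relators (W : seq (seq letter)) : Prop :=
  ~ exists U : seq (seq letter),
      [/\ subseq U W, U != W & sym_closure U =i sym_closure W].

Definition power_free (w : seq letter) : Prop :=
  size (undup (sym_closure [:: w])) = 2 * size w.

Definition small_cancellation (R : realType) (lambda : R)
    (W : seq (seq letter)) : Prop :=
  [/\ minimal_relators W,
      (forall w, w \in W -> power_free w)
    & forall u w, u \in sym_closure W -> w \in sym_closure W -> u != w ->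
      forall p a b,
        freely_reduced p -> freely_reduced a -> freely_reduced b ->
        u = fmul p a -> w = fmul p b ->
        size u = size p + size a -> size w = size p + size b ->
        ((size p)%:R < lambda * (minn (size u) (size w))%:R)%R].

(* Ordered lists of m cyclically reduced words of length l. *)
Definition presentations (l m : nat) : {set m.-tuple (l.-tuple letter)} :=
  [set W : m.-tuple (l.-tuple letter)
     | all (fun w : l.-tuple letter => cyclically_reduced w) W].

Definition prob_small_cancellation (R : realType) (lambda : R) (l m : nat) : R :=
  (#|[set W in presentations l m
        | `[< small_cancellation lambda [seq tval w | w <- W] >] ]|%:R
   / #|presentations l m|%:R)%R.

End Words.

Local Open Scope ring_scope.

Section Bounds.
Variable R : realType.

(* Integer exponent: FR r 0 = 2r / (2r - 1). *)
Definition FR (r k : nat) : R :=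
  2 * r%:R * (2 * r%:R - 1) ^ (k%:Z - 1).

Definition CR (r k : nat) : R :=
  (2 * r%:R - 1) ^+ k + 1 + (r%:R - 1) * (1 + (-1) ^+ k).

Definition nat_ceil (x : R) : nat := `|Num.ceil x|%N.

(* In the following, c stands for the ceiling of lambda * l, and l2 for the
   remainder of l modulo c.  The integer exponent in [omega] is -1 when
   l = c = 1. *)
Definition omega (r l c i : nat) : R :=
  CR r l - 4 * (i%:R - 1) * l%:R * (r%:R - 1)
           * (2 * r%:R - 1) ^ (l%:Z - c%:Z - 1).

Definition beta (r l2 : nat) : R := FR r l2.

Definition alpha (r l c l2 i k : nat) : R :=
  if k == 1%N then FR r c - 2 * (i%:R - 1) * l%:R
  else FR r c - 2 * (i%:R - 1) * l%:R
       - 2 * ((k%:R - 2) * c%:R + l2%:R + 1).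

End Bounds.

(* Main.v *)
Require Import Defs.
From mathcomp Require Import all_boot all_order all_algebra.
From mathcomp Require Import boolp reals.
From mathcomp Require Import zify ring lra.

Set Implicit Arguments.
Unset Strict Implicit.
Unset Printing Implicit Defensive.

Import Order.TTheory GRing.Theory Num.Theory.
Local Open Scope ring_scope.

(* In a small cancellation presentation the 2ml elements of the symmetric
   closure have pairwise distinct prefixes of length c = ceil (lambda l).  These
   prefixes are the cyclic subwords of length c of the relators and their
   inverses, so 2ml <= FR(r, c).  Choose the relators one after the other; the
   i-th one has no subword in the set P of the 2(i-1)l words used by its
   predecessors.  On the one hand its prefix of length c is not in P, while each
   word of P is the prefix of at least 2(r-1)(2r-1)^(l-c-1) cyclically reduced
   words: this gives omega.  On the other hand, reading it as a word of length l2
   followed by l1 blocks of length c, each block is a reduced continuation of the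
   previous ones and avoids P, the earlier subwords of the same relator and
   their inverses: this gives beta and alpha. *)

(** * Sequences *)

Section Sequences.

Lemma size_undup_map_le (T U V : eqType) (f : T -> U) (e : T -> V) (s : seq T) :
    {in s &, forall x y, e x = e y -> f x = f y} ->
  (size (undup (map f s)) <= size (undup (map e s)))%N.
Proof.
elim: s => //= x s IHs fe.
have {}IHs : (size (undup (map f s)) <= size (undup (map e s)))%N.
  by apply: IHs => y z ys zs; apply: fe; rewrite inE ?ys ?zs orbT.
case: ifPn => [_|fx]; first by case: ifP => _ //=; apply: leqW.
case: ifPn => //= /mapP[y ys exy].
by case/mapP: fx; exists y => //; apply: fe; rewrite ?inE ?eqxx ?ys ?orbT.
Qed.

(** Here and below, [size (undup (map f s))] counts the distinct values of [f] on [s]. Grouping the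
    pairs by first component, each group contributes at most [B]. *)
Lemma size_undup_pair_le (R : realType) (T U V : eqType) (g : T -> U)
    (h : T -> V) (s : seq T) (B : R) :
    {in s, forall x, (size (undup [seq h y | y <- s & g y == g x]))%:R <= B} ->
  (size (undup [seq (g x, h x) | x <- s]))%:R
    <= (size (undup (map g s)))%:R * B.
Proof.
move=> hB; pose F u := undup [seq h y | y <- s & g y == u].
have : (size (undup [seq (g x, h x) | x <- s])
         <= size [seq (u, v) | u <- undup (map g s), v <- F u])%N.
  apply: uniq_leq_size (undup_uniq _) _ => uv.
  rewrite mem_undup => /mapP[x xs ->].
  apply/allpairsPdep; exists (g x), (h x).
  rewrite !mem_undup map_f //; split=> //.
  by apply/mapP; exists x; rewrite ?mem_filter ?eqxx.
rewrite -(ler_nat R) => /le_trans; apply; rewrite size_allpairs_dep.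
have : {in undup (map g s), forall u, (size (F u))%:R <= B}.
  by move=> _ /[!mem_undup] /mapP[x xs ->]; apply: hB.
elim: (undup _) => [|u r IHr] FB /=; first by rewrite mul0r.
rewrite natrD -natr1 mulrDl mul1r addrC lerD ?FB ?mem_head //.
by apply: IHr => v vr; apply: FB; rewrite inE vr orbT.
Qed.

(** The inductive step of both counts of initial segments: [g] is a segment, [h] the next block or
    relator, and together they determine the longer segment [f]. *)
Lemma size_undup_extend (R : realType) (T U V W : eqType) (f : T -> W)
    (g : T -> U) (h : T -> V) (s : seq T) (B : R) :
    {in s &, forall x y, g x = g y -> h x = h y -> f x = f y} ->
    {in s, forall x, (size (undup [seq h y | y <- s & g y == g x]))%:R <= B} ->
  (size (undup (map f s)))%:R <= (size (undup (map g s)))%:R * B.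
Proof.
move=> fgh hB; apply: le_trans (size_undup_pair_le hB); rewrite ler_nat.
by apply: size_undup_map_le => x y xs ys [gxy hxy]; apply: fgh.
Qed.

Lemma disjoint_size_le (T : eqType) (s t u : seq T) :
    uniq s -> uniq t -> {in s, forall x, x \notin t} ->
    {subset s <= u} -> {subset t <= u} ->
  (size s + size t <= size u)%N.
Proof.
move=> s_uniq t_uniq st su tu; rewrite -size_cat; apply: uniq_leq_size.
  rewrite cat_uniq s_uniq t_uniq andbT; apply/hasPn => x xt.
  by apply: contraL xt => /st.
by move=> x; rewrite mem_cat => /orP[/su|/tu].
Qed.

Lemma size_allpairs_const (S T U : Type) (f : S -> T -> U) (s : seq S)
    (t : S -> seq T) (k : nat) :
    (forall x, size (t x) = k) ->
  size [seq f x y | x <- s, y <- t x] = (size s * k)%N.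
Proof.
by move=> tk; elim: s => //= x s IHs; rewrite size_cat size_map tk IHs.
Qed.

End Sequences.

Section AllWords.
Variable T : eqType.

(** Serves twice: with letters as entries, and with cyclically reduced words as entries, which gives
    lists of relators. *)
Fixpoint words (s : seq T) (k : nat) : seq (seq T) :=
  if k is k'.+1 then [seq x :: w | x <- s, w <- words s k'] else [:: [::]].

Lemma mem_words s k w : (w \in words s k) = (size w == k) && all (mem s) w.
Proof.
elim: k w => [|k IHk] [|x w] //=.
  by apply/allpairsP => -[[y v] []].
rewrite eqSS andbCA -IHk; apply/allpairsP/andP => [[[y v] /= [ys vw [-> ->]]]//|].
by case=> xs ws; exists (x, w).
Qed.

Lemma size_words s k : size (words s k) = (size s ^ k)%N.
Proof. by elim: k => //= k IHk; rewrite size_allpairs IHk expnS. Qed.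

Lemma uniq_words s k : uniq s -> uniq (words s k).
Proof.
move=> s_uniq; elim: k => //= k IHk; apply: allpairs_uniq => //.
by move=> [x v] [y w] _ _ /= [-> ->].
Qed.

End AllWords.

(** * Counting cyclically reduced words *)

Section Walks.
Variable X : finType.
Local Notation letter := (letter X).
Local Notation letters := (enum {: letter}).
Implicit Types (x y z : letter) (w u v : seq letter).

Definition follows : rel letter := fun x y => y != linv x.

Arguments follows : simpl never.

Lemma freely_reducedE w : freely_reduced w = sorted follows w.
Proof. by []. Qed.

Lemma linvK : involutive (@linv X).
Proof. by case=> x b; rewrite /linv /= negbK. Qed.

Lemma linv_neq x : x != linv x.
Proof. by case: x => x b; rewrite /linv xpair_eqE /= eqxx; case: b. Qed.

Lemma follows_sym : symmetric follows.
Proof.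
by move=> x y; rewrite /follows -(can_eq linvK x) linvK eq_sym.
Qed.

(** The rotations by 0 and 1 together show every adjacent pair, the closing one included. A single
    letter has one rotation only, but its closing pair is allowed since no letter is its own
    inverse. *)
Lemma cyclically_reducedE w : cyclically_reduced w = cycle follows w.
Proof.
apply/allP/idP => [w_red|w_cyc d _]; last first.
  rewrite freely_reducedE; move: w_cyc; rewrite -(rot_cycle d).
  by case: (rot d w) => //= x p; rewrite rcons_path => /andP[].
case: w w_red => // x [|y p] w_red; first by rewrite /= /follows linv_neq.
have:= w_red 1 isT; have:= w_red 0 isT.
by rewrite !freely_reducedE rot0 rot1_cons /= => /andP[-> _].
Qed.

(** The [k] letters lie strictly between [x] and [z]; with [z = x] these are the cyclically reduced
    words of length [k+1] beginning with [x]. *)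
Definition walks x z k :=
  count (fun w => path follows x (rcons w z)) (words letters k).

Lemma walks0 x z : walks x z 0 = follows x z.
Proof. by rewrite /walks /= andbT addn0. Qed.

Lemma walksS x z k : walks x z k.+1 = (\sum_(y | follows x y) walks y z k)%N.
Proof.
rewrite /walks /= count_flatten -map_comp sumnE big_map big_enum /=.
rewrite [RHS]big_mkcond; apply: eq_bigr => y _ /=.
rewrite count_map; case: ifP => xy; first by apply: eq_count => w /=; rewrite xy.
by rewrite (eq_count (a2 := pred0)) ?count_pred0 // => w /=; rewrite xy.
Qed.

Lemma count_words (P : pred (seq letter)) k :
  count P (words letters k.+1) =
  (\sum_x count (fun w => P (x :: w)) (words letters k))%N.
Proof.
rewrite /= count_flatten -map_comp sumnE big_map big_enum /=.
by apply: eq_bigr => x _ /=; rewrite count_map.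
Qed.

Lemma card_letter : #|{: letter}| = (2 * #|X|)%N.
Proof. by rewrite card_prod card_bool mulnC. Qed.

Lemma card_follows x : #|follows x| = (2 * #|X|).-1.
Proof.
rewrite -card_letter -(cardC1 (linv x)); apply: eq_card => y.
by rewrite !inE.
Qed.

(** Each of the first [k] letters has [2 * #|X| - 1] choices; the last one must avoid the inverses
    of its predecessor and of [z], which excludes at most two letters. *)
Lemma walks_ge x z k :
  ((2 * #|X| - 2) * (2 * #|X|).-1 ^ k <= walks x z k.+1)%N.
Proof.
elim: k x => [|k IHk] x.
  rewrite walksS expn0 muln1; under eq_bigr do rewrite walks0.
  rewrite -big_mkcondr sum1_card /= subn2 -(card_follows x).
  rewrite (cardD1 (linv z)) -subn1 leq_subLR.
  rewrite leq_add ?leq_b1 ?subset_leq_card //; apply/subsetP => y.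
  by rewrite inE => /andP[yz xy]; apply/andP; split; rewrite // follows_sym.
rewrite walksS expnS mulnCA -(card_follows x) -sum_nat_const.
rewrite [leqLHS](eq_bigl _ _ (fun y => erefl)) leq_sum // => y _.
by rewrite card_follows.
Qed.

Section ClosedForm.
Variable R : realType.
Local Notation n := (2 * #|X|%:R : R).

Lemma sum_follows x (f : letter -> R) :
  \sum_(y | follows x y) f y = \sum_y f y - f (linv x).
Proof. by rewrite [\sum_y _](bigD1 (linv x)) //= addrAC subrr add0r. Qed.

(* With J the all-ones matrix and P the matrix of the involution linv, walks of
   length k+1 are counted by (J - P)^(k+1), where J^2 = nJ, JP = PJ = J and
   P^2 = 1. *)
Lemma walks_closed_form x z k :
  n * (walks x z k)%:R =
  (n - 1) ^+ k.+1 + (-1) ^+ k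
    - n * (-1) ^+ k * (z == if odd k then x else linv x)%:R.
Proof.
elim: k x => [|k IHk] x.
  by rewrite walks0 /follows /= !expr0 expr1 mulr1; case: eqP => _ /=; lra.
rewrite walksS natr_sum mulr_sumr; under eq_bigr do rewrite IHk.
rewrite sumrB sumr_const card_follows -mulr_sumr.
(* Over all [y] exactly one indicator is 1, and the omitted [y = linv x] carries the indicator for
   [k+1]. *)
have ->: \sum_(y | follows x y) ((z == if odd k then y else linv y)%:R : R) 
   = 1 - (z == if odd k.+1 then x else linv x)%:R.
  rewrite sum_follows /= if_neg linvK; congr (_ - _).
  rewrite (bigD1 (if odd k then z else linv z)) //= big1 => [|y].
    by case: (odd k); rewrite ?linvK eqxx addr0.
  case: (odd k); first by rewrite eq_sym => /negPf->.
  by rewrite -(can_eq linvK) linvK eq_sym => /negPf->.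
have [X0|X1] := posnP #|X|.
  by case: (x) => t; have := fintype0 t X0.
rewrite -[_ *+ _]mulr_natr -[(2 * _).-1]subn1 natrB ?natrM; last by lia.
by rewrite !exprS; ring.
Qed.

(** A cyclically reduced word is a closed walk from its first letter [x] to itself. For [z = x] the
    closed form depends only on the parity of [l], because [x] differs from [linv x]. *)
Lemma count_cyclic l : (0 < #|X|)%N -> (0 < l)%N ->
  (count (cycle follows) (words letters l))%:R = CR R #|X| l.
Proof.
case: l => // l X1 _; rewrite count_words natr_sum.
have n0 : n != 0 by rewrite mulf_neq0 ?pnatr_eq0 // -lt0n.
apply: (mulfI n0); rewrite mulr_sumr.
rewrite (eq_bigr (fun=> (n - 1) ^+ l.+1 + (-1) ^+ l - n * (-1) ^+ l * (odd l)%:R)).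
  rewrite sumr_const card_letter -[LHS]mulr_natl natrM /CR -signr_odd exprS.
  rewrite -[(-1) ^+ l.+1]signr_odd /=.
  by case: (odd l); rewrite /= ?expr0 ?expr1; ring.
move=> x _; rewrite walks_closed_form.
by case: (odd l); rewrite ?eqxx ?(negPf (linv_neq x)).
Qed.

End ClosedForm.
End Walks.

(** * Cyclic subwords of small cancellation presentations *)

(* Otherwise finv would be the inverse of a function on a finite type, since
   all_boot is imported after Defs. *)
Local Notation finv := Defs.finv.

Section SymmetricClosure.
Variable X : finType.
Local Notation letter := (letter X).
Local Notation letters := (enum {: letter}).
Implicit Types (x y z : letter) (w u v : seq letter) (W : seq (seq letter)).

Lemma finv_cat u v : finv (u ++ v) = finv v ++ finv u.
Proof. by rewrite /finv map_cat rev_cat. Qed.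

Lemma size_finv w : size (finv w) = size w.
Proof. by rewrite size_rev size_map. Qed.

Lemma finvK : involutive (@Defs.finv X).
Proof. by move=> w; rewrite /finv map_rev revK mapK //; apply: linvK. Qed.

Lemma finv_rotr n w : finv (rotr n w) = rot n (finv w).
Proof. by rewrite /finv map_rotr rev_rotr. Qed.

Lemma freely_reduced_finv w : freely_reduced (finv w) = freely_reduced w.
Proof.
rewrite !freely_reducedE rev_sorted sorted_map; apply: eq_sorted => x y /=.
by rewrite /follows (can_eq (@linvK X)) eq_sym -(can_eq (@linvK X)) linvK.
Qed.

Lemma free_reduce_id w : freely_reduced w -> free_reduce w = w.
Proof.
rewrite freely_reducedE; elim: w => // x [|y w] IHw // /= /andP[xy yw].
by rewrite -[LHS]/(push x (free_reduce (y :: w))) IHw //= (negPf xy).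
Qed.

Lemma freely_reduced_take n w : freely_reduced w -> freely_reduced (take n w).
Proof. exact: take_sorted. Qed.

Lemma freely_reduced_drop n w : freely_reduced w -> freely_reduced (drop n w).
Proof. exact: drop_sorted. Qed.

Lemma freely_reduced_rot n w : cyclically_reduced w -> freely_reduced (rot n w).
Proof.
rewrite cyclically_reducedE -(rot_cycle n) freely_reducedE.
by case: (rot n w) => //= x p; rewrite rcons_path => /andP[].
Qed.

Definition conjugates w : seq (seq letter) :=
  flatten [seq [:: rot d w; finv (rot d w)] | d <- iota 0 (size w)].

Lemma size_pairs (T : Type) (f g : nat -> T) s :
  size (flatten [seq [:: f d; g d] | d <- s]) = (2 * size s)%N.
Proof. by elim: s => //= d s ->; rewrite mulnS. Qed.

(** No bound on [d] is needed, since rotating by at least the length does nothing; this makes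
    conjugates easy to compose. *)
Lemma mem_conjugates w u : (0 < size w)%N ->
  reflect (exists d, u = rot d w \/ u = finv (rot d w)) (u \in conjugates w).
Proof.
move=> w0; apply: (iffP flatten_mapP) => [[d _]|[d ud]].
  by rewrite !inE => /orP[]/eqP->; exists d; [left|right].
have [dw|wd] := ltnP d (size w).
  by exists d; rewrite ?mem_iota // !inE; case: ud => <-; rewrite eqxx ?orbT.
exists 0; rewrite ?mem_iota // !inE rot0.
by move: ud; rewrite rot_oversize // => -[] <-; rewrite eqxx ?orbT.
Qed.

Lemma size_conjugate w u : u \in conjugates w -> size u = size w.
Proof.
move=> /flatten_mapP[d _]; rewrite !inE.
by case/orP => /eqP->; rewrite ?size_finv size_rot.
Qed.

Lemma sub_conjugates w u : (0 < size w)%N -> u \in conjugates w ->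
  {subset conjugates u <= conjugates w}.
Proof.
move=> w0 uw v; have u0 : (0 < size u)%N by rewrite (size_conjugate uw).
move/(mem_conjugates _ w0): uw => [d ud].
move/(mem_conjugates _ u0) => [e ve]; apply/(mem_conjugates _ w0).
case: ud ve => -> [] ->; rewrite -?finv_rotr ?finvK /rotr rot_rot_add;
  by eexists; by [left|right].
Qed.

Lemma conjugates_sym w u : (0 < size w)%N -> u \in conjugates w ->
  w \in conjugates u.
Proof.
move=> w0 uw; have u0 : (0 < size u)%N by rewrite (size_conjugate uw).
move/(mem_conjugates _ w0): uw => [d [] ud]; apply/(mem_conjugates _ u0).
  by exists (size u - d)%N; left; rewrite ud -/(rotr d _) rotK.
by exists d; right; rewrite ud -finv_rotr finvK rotK.
Qed.

(** Being a rotation of a word or of its inverse is an equivalence relation, so two such classes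
    that meet coincide. *)
Lemma eq_conjugates w u : (0 < size w)%N -> u \in conjugates w ->
  conjugates u =i conjugates w.
Proof.
move=> w0 uw v; have u0 : (0 < size u)%N by rewrite (size_conjugate uw).
have wu := conjugates_sym w0 uw.
by apply/idP/idP; [apply: (sub_conjugates w0 uw)|apply: (sub_conjugates u0 wu)].
Qed.

Lemma sym_closure1 w : sym_closure [:: w] = conjugates w.
Proof. exact: cats0. Qed.

Lemma sym_closure_cons w W :
  sym_closure (w :: W) = conjugates w ++ sym_closure W.
Proof. by []. Qed.

Lemma minimal_relators_behead w W :
  minimal_relators (w :: W) -> minimal_relators W.
Proof.
move=> minW [U [UW neqUW eqUW]]; apply: minW; exists (w :: U); split.
- by rewrite /= eqxx.
- by apply: contraNneq neqUW => -[->].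
- by move=> x; rewrite !sym_closure_cons !mem_cat eqUW.
Qed.

(** Power-freeness excludes repetitions within one relator. If two relators shared a conjugate,
    their classes would coincide and one of them could be dropped, against minimality. *)
Lemma uniq_sym_closure W :
    {in W, forall w, 0 < size w}%N -> minimal_relators W ->
    {in W, forall w, power_free w} ->
  uniq (sym_closure W).
Proof.
elim: W => // w W IHW sz_gt0 minW pfW.
have w0 : (0 < size w)%N by rewrite sz_gt0 ?mem_head.
rewrite sym_closure_cons cat_uniq {}IHW ?andbT; first last.
- by move=> v vW; apply: pfW; rewrite inE vW orbT.
- exact: minimal_relators_behead minW.
- by move=> v vW; apply: sz_gt0; rewrite inE vW orbT.
apply/andP; split.
  have := pfW w (mem_head _ _); rewrite /power_free sym_closure1 => pfw.
  rewrite -[uniq _]negbK -ltn_size_undup pfw.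
  by rewrite /conjugates size_pairs size_iota ltnn.
apply/hasPn => u /flatten_mapP[v vW uv]; apply/negP => uw.
have v0 : (0 < size v)%N by rewrite sz_gt0 ?inE ?vW ?orbT.
apply: minW; exists W; split; first exact: subseq_cons.
  by apply/eqP => /(congr1 size) /= /n_Sn.
move=> x; rewrite sym_closure_cons mem_cat; apply/idP/orP => [|[|//]]; first by right.
rewrite -(eq_conjugates w0 uw) (eq_conjugates v0 uv) => xv.
by apply/flatten_mapP; exists v.
Qed.

(** The parameter [n] restricts the starting positions, so that subwords inside a known prefix can
    be singled out; [n = size w] gives all cyclic subwords. *)
Definition occurrences c n w : seq (seq letter) :=
  flatten [seq [:: take c (rot d w); finv (take c (rot d w))] | d <- iota 0 n].

Lemma size_occurrences c n w : size (occurrences c n w) = (2 * n)%N.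
Proof. by rewrite size_pairs size_iota. Qed.

Lemma mem_occurrences c w u : (0 < size w)%N ->
  reflect (exists d, u = take c (rot d w) \/ u = finv (take c (rot d w)))
    (u \in occurrences c (size w) w).
Proof.
move=> w0; apply: (iffP flatten_mapP) => [[d _]|[d ud]].
  by rewrite !inE => /orP[]/eqP->; exists d; [left|right].
have [dw|wd] := ltnP d (size w).
  by exists d; rewrite ?mem_iota // !inE; case: ud => <-; rewrite eqxx ?orbT.
exists 0; rewrite ?mem_iota // !inE rot0.
by move: ud; rewrite rot_oversize // => -[] <-; rewrite eqxx ?orbT.
Qed.

Lemma take_finv c w : (c <= size w)%N ->
  take c (finv w) = finv (take c (rot (size w - c) w)).
Proof.
move=> cw; rewrite -{1}(cat_take_drop (size w - c) w) finv_cat take_size_cat.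
  by rewrite take_size_cat // size_drop subKn.
by rewrite size_finv size_drop subKn.
Qed.

(** A prefix of an inverted rotation is the inverse of a suffix of that rotation, hence of a cyclic
    subword. The order of the two lists differs. *)
Lemma mem_conjugate_prefixes c w : (0 < size w)%N -> (c <= size w)%N ->
  map (take c) (conjugates w) =i occurrences c (size w) w.
Proof.
move=> w0 cw u; apply/mapP/(mem_occurrences _ _ w0) => [[v]|[d ud]].
  move/(mem_conjugates _ w0) => [d [] ->] ->; first by exists d; left.
  rewrite take_finv size_rot // rot_rot_add.
  by eexists; right.
case: ud => ->.
  by exists (rot d w) => //; apply/(mem_conjugates _ w0); exists d; left.
(* Rotating by [c] moves the block to the end, and inversion brings its inverse to the front. *)
exists (finv (rot c (rot d w))).
  by apply/(mem_conjugates _ w0); rewrite rot_rot_add; eexists; right.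
by rewrite take_finv !size_rot //; have := rotK c (rot d w);
  rewrite /rotr !size_rot => ->.
Qed.

(** The two lists have the same members and the same length, so they are repetition-free
    together. *)
Lemma uniq_occurrences c W :
    {in W, forall w, 0 < size w}%N -> {in W, forall w, c <= size w}%N ->
    uniq (map (take c) (sym_closure W)) ->
  uniq (flatten [seq occurrences c (size w) w | w <- W]).
Proof.
move=> sz_gt0 cW; rewrite -(@eq_uniq _ (map (take c) (sym_closure W))) //.
  rewrite size_map !size_flatten /shape -!map_comp; congr sumn.
  apply: eq_map => w /=; rewrite size_occurrences.
  by rewrite -[size _]/(size (conjugates w)) size_pairs size_iota.
elim: W sz_gt0 cW => // w W IHW sz_gt0 cW u.
rewrite sym_closure_cons map_cat /= !mem_cat IHW.
- by rewrite mem_conjugate_prefixes ?sz_gt0 ?cW ?mem_head.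
- by move=> v vW; apply: sz_gt0; rewrite inE vW orbT.
- by move=> v vW; apply: cW; rewrite inE vW orbT.
Qed.

Lemma freely_reduced_sym_closure W u :
    {in W, forall w, cyclically_reduced w} -> u \in sym_closure W ->
  freely_reduced u.
Proof.
move=> cycW /flatten_mapP[w wW] /flatten_mapP[d _]; rewrite !inE.
by case/orP => /eqP->; rewrite ?freely_reduced_finv freely_reduced_rot ?cycW.
Qed.

Lemma small_cancellation_uniq (R : realType) (lambda : R) l c W :
    (0 < l)%N -> (c <= l)%N -> lambda * l%:R <= c%:R ->
    {in W, forall w, cyclically_reduced w && (size w == l)} ->
    small_cancellation lambda W ->
  uniq (flatten [seq occurrences c l w | w <- W]).
Proof.
move=> l0 cl lc hW [minW pfW scW].
have cycW w : w \in W -> cyclically_reduced w by case/hW/andP.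
have sizeW w : w \in W -> size w = l by case/hW/andP => _ /eqP.
rewrite (_ : [seq _ | w <- W] = [seq occurrences c (size w) w | w <- W]); last first.
  by apply/eq_in_map => w /sizeW ->.
apply: uniq_occurrences => [w /sizeW->//|w /sizeW->//|].
rewrite map_inj_in_uniq; first by apply: uniq_sym_closure => // w /sizeW->.
move=> u v uW vW uv; apply/eqP/negPn/negP => neq_uv.
have size_cl t : t \in sym_closure W -> size t = l.
  by case/flatten_mapP => w /sizeW <- /size_conjugate.
have red t : t \in sym_closure W -> freely_reduced t.
  exact: freely_reduced_sym_closure.
have split_c t : t \in sym_closure W ->
    t = fmul (take c t) (drop c t) /\ size t = (size (take c t) + size (drop c t))%N.
  move=> tW; rewrite /fmul cat_take_drop free_reduce_id ?red //.
  by rewrite -size_cat cat_take_drop.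
have [uE su] := split_c u uW; have [vE sv] := split_c v vW.
rewrite -uv in vE sv.
have := scW u v uW vW neq_uv _ _ _ _ _ _ uE vE su sv.
rewrite freely_reduced_take ?freely_reduced_drop ?red // => /(_ isT isT isT).
by rewrite size_takel (size_cl u uW) // (size_cl v vW) minnn ltNge lc.
Qed.

(** * Enumerating reduced words and bounding blocks and prefixes *)

Fixpoint extensions x k : seq (seq letter) := 
  if k is k'.+1 then [seq y :: w | y <- enum (follows x), w <- extensions y k']
  else [:: [::]].

Lemma mem_extensions x k w :
  path (@follows X) x w -> size w = k -> w \in extensions x k.
Proof.
elim: k x w => [|k IHk] x [|y w] //= /andP[xy yw] [sw].
by apply/allpairsPdep; exists y, w; rewrite mem_enum IHk.
Qed.

Lemma size_extensions x k : size (extensions x k) = ((2 * #|X|).-1 ^ k)%N.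
Proof.
elim: k x => [|k IHk] x //=.
by rewrite (size_allpairs_const _ _ IHk) -cardE card_follows expnS.
Qed.

Lemma size_path_le x k (s : seq (seq letter)) : uniq s ->
    {in s, forall w, path (@follows X) x w && (size w == k)} ->
  (size s <= (2 * #|X|).-1 ^ k)%N.
Proof.
move=> s_uniq hs; rewrite -(size_extensions x k); apply: uniq_leq_size => // w.
by move=> /hs /andP[xw /eqP]; apply: mem_extensions.
Qed.

(** Meant for positive [k]: at 0 the predecessor makes it the list of one-letter words. *)
Definition reduced_words k : seq (seq letter) :=
  [seq x :: w | x <- letters, w <- extensions x k.-1].

Lemma size_reduced_words k :
  size (reduced_words k) = (2 * #|X| * (2 * #|X|).-1 ^ k.-1)%N.
Proof.
rewrite (size_allpairs_const _ _ (fun x => size_extensions x k.-1)).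
by rewrite -cardE card_letter.
Qed.

Lemma mem_reduced_words k w : (0 < k)%N -> freely_reduced w -> size w = k ->
  w \in reduced_words k.
Proof.
move=> k0; case: w => [|x w]; first by move=> _ k0'; rewrite -k0' in k0.
rewrite freely_reducedE /= => xw <-; apply/allpairsPdep; exists x, w.
by rewrite mem_enum mem_extensions.
Qed.

Lemma freely_reduced_occurrence c n w u : cyclically_reduced w ->
  (c <= size w)%N -> u \in occurrences c n w -> freely_reduced u && (size u == c).
Proof.
move=> w_cyc cw /flatten_mapP[d _]; rewrite !inE.
by case/orP => /eqP->; rewrite ?freely_reduced_finv ?size_finv size_takel
  ?size_rot // eqxx andbT freely_reduced_take ?freely_reduced_rot.
Qed.

Lemma take_rot c d u v : take (size v) u = v -> (d + c <= size v)%N ->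
  (size v <= size u)%N -> take c (rot d u) = take c (drop d v).
Proof.
move=> uv dv vu; rewrite takel_cat ?size_drop; last by lia.
by rewrite !take_drop -uv take_takel // addnC.
Qed.

(* P stands for the words of length c excluded by the previous relators; the
   2n occurrences inside the prefix v are excluded as well. *)
Lemma size_next_block_le c n P v (s : seq (seq letter)) :
    (0 < c)%N -> (forall d, d < n -> d + c <= size v)%N -> (0 < size s)%N ->
    {in P, forall u, freely_reduced u && (size u == c)} ->
    {in s, forall w, [/\ cyclically_reduced w, (size v + c <= size w)%N,
       take (size v) w = v & uniq (P ++ occurrences c (size w) w)]} ->
  (size (undup [seq take c (drop (size v) w) | w <- s]) + (size P + 2 * n)
     <= 2 * #|X| * (2 * #|X|).-1 ^ c.-1)%N.
Proof.
move=> c0 hn s0 hP hs; case: s s0 hs => // w s _ hs.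
set E := undup _.
pose inside := [seq [:: take c (drop d v); finv (take c (drop d v))] | d <- iota 0 n].
have insideE u : u \in w :: s -> P ++ occurrences c n u = P ++ flatten inside.
  move=> /hs[_ vu uv _]; congr (_ ++ flatten _); apply/eq_in_map => d.
  by rewrite mem_iota => /andP[_ /hn dv]; rewrite !(take_rot uv) //; lia.
have nv : (n <= size v)%N by case: (n) hn => // n' /(_ n' (ltnSn _)); lia.
(* The block after [v] is the subword at position [size v], beyond the first [n] positions;
   uniqueness of the whole list thus keeps it out of [P] and of [inside]. *)
have split_occ u : u \in w :: s -> exists s1 s2,
    occurrences c (size u) u = occurrences c n u ++ s1 ++
      [:: take c (drop (size v) u), finv (take c (drop (size v) u)) & s2].
  move=> /hs[_ vu uv _].
  have -> : size u = (n + ((size v - n) + (size u - (size v).+1).+1))%N by lia.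
  rewrite /occurrences !iotaD !map_cat !flatten_cat /= add0n subnKC //.
  rewrite [take c (rot (size v) u)]takel_cat; last by rewrite size_drop; lia.
  by do 2 eexists.
rewrite -(size_reduced_words c) -(size_occurrences c n w) -size_cat.
rewrite insideE ?mem_head //.
apply: disjoint_size_le; rewrite ?undup_uniq //.
- have [_ _ _] := hs w (mem_head _ _).
  have [s1 [s2 ->]] := split_occ w (mem_head _ _).
  by rewrite (catA P) cat_uniq -(insideE w) ?mem_head // => /andP[].
- move=> x; rewrite mem_undup => /mapP[u us ->].
  have [_ _ _] := hs u us.
  have [s1 [s2 ->]] := split_occ u us.
  rewrite (catA P) insideE // cat_uniq => /and3P[_ /hasPn + _].
  by apply; rewrite mem_cat mem_head orbT.
- move=> x; rewrite mem_undup => /mapP[u us ->]; have [u_cyc vu _ _] := hs u us.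
  apply: mem_reduced_words => //; last by rewrite size_takel // size_drop; lia.
  rewrite freely_reduced_take // freely_reduced_drop //.
  by rewrite -[u]rot0 freely_reduced_rot.
- move=> x; rewrite -(insideE w) ?mem_head // mem_cat.
  have [w_cyc vw _ _] := hs w (mem_head _ _).
  have cw : (c <= size w)%N by lia.
  by case/orP => [/hP|/(freely_reduced_occurrence w_cyc cw)] /andP[? /eqP];
    apply: mem_reduced_words.
Qed.

(** The prefix of a word of [s] is one of its own occurrences, hence outside [P]. So [s] is disjoint
    from [Q], the cyclically reduced words with prefix in [P], and [Q] has at least [B] members for
    each of these prefixes. *)
Lemma size_occurrence_prefixes_le c l P (s : seq (seq letter)) (B : nat) :
    uniq s -> (c <= l)%N -> (0 < c)%N ->
    {in s, forall w, [/\ cyclically_reduced w, size w = l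
       & uniq (P ++ occurrences c l w)]} ->
    uniq P ->
    {in P, forall p, B <=
       count (fun w => cycle (@follows X) w && (take c w == p)) (words letters l)}%N ->
  (size s + size P * B <= count (cycle (@follows X)) (words letters l))%N.
Proof.
move=> s_uniq cl c0 hs P_uniq hB.
pose Q := [seq w <- words letters l | cycle (@follows X) w && (take c w \in P)].
have: (size P * B <= size Q)%N.
  rewrite size_filter {hs}; elim: P P_uniq hB {Q} => // p P IHP /= /andP[pP P_uniq] hB.
  rewrite mulSn (leq_trans (leq_add (hB p (mem_head _ _)) (IHP P_uniq _))) //.
    by move=> u uP; apply: hB; rewrite inE uP orbT.
  rewrite -count_predUI [X in (_ + X <= _)%N](eq_count (a2 := pred0)) ?count_pred0.
    rewrite addn0; apply: sub_count => w /=.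
    by rewrite inE; case: cycle => //=.
  move=> w /=; case: eqP => [->|]; by rewrite ?(negPf pP) ?andbF.
rewrite -(leq_add2l (size s)) => /leq_trans; apply; rewrite -size_filter.
have w_letters w : size w = l -> w \in words letters l.
  by rewrite mem_words => ->; rewrite eqxx; apply/allP => x _; rewrite /= mem_enum.
apply: disjoint_size_le; rewrite ?filter_uniq ?uniq_words ?enum_uniq //.
- move=> w /hs[_ wl]; rewrite mem_filter cat_uniq => /and3P[_ /hasPn wP _].
  have : take c w \in occurrences c l w.
    apply/flatten_mapP; exists 0; first by rewrite mem_iota; lia.
    by rewrite rot0 mem_head.
  by move=> /wP /negPf ->; rewrite andbF.
- move=> w /hs[w_cyc wl _].
  by rewrite mem_filter -cyclically_reducedE w_cyc w_letters.
- by move=> w; rewrite !mem_filter => /andP[/andP[-> _] ->].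
Qed.

(** Completing [p] to a cyclically reduced word means walking from its last letter back to its first
    through [l - c] further letters. *)
Lemma count_prefix_ge c l p : freely_reduced p -> size p = c -> (0 < c < l)%N ->
  ((2 * #|X| - 2) * (2 * #|X|).-1 ^ (l - c).-1
     <= count (fun w => cycle (@follows X) w && (take c w == p)) (words letters l))%N.
Proof.
case: p => [|x p] p_red pc /andP[c0 cl]; first by rewrite -pc in c0.
apply: leq_trans (walks_ge (last x p) x _) _; rewrite -[walks _ _ _]size_filter.
rewrite -(size_map (cat (x :: p))) -size_filter; apply: uniq_leq_size.
  rewrite map_inj_uniq ?filter_uniq ?uniq_words ?enum_uniq // => u v /eqP.
  by rewrite eqseq_cat // eqxx => /eqP.
move=> w /mapP[u]; rewrite !mem_filter mem_words => /andP[pu /andP[/eqP ul _]] ->.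
have -> : x :: p ++ u \in words letters l.
  rewrite mem_words -cat_cons size_cat pc ul; apply/andP; split.
    by apply/eqP; lia.
  by apply/allP => y _; rewrite /= mem_enum.
rewrite take_cat -pc ltnn subnn take0 cats0 eqxx !andbT.
by rewrite /= rcons_cat cat_path pu andbT -[path _ _ _]/(freely_reduced (x :: p)).
Qed.

End SymmetricClosure.

(** * Positivity of the bounds *)

Section Quantities.
Variable R : realType.

Lemma nat_ceil_ge (x : R) : 0 <= x -> x <= (nat_ceil x)%:R.
Proof.
move=> x0; rewrite /nat_ceil pmulrn gez0_abs ?ceil_ge //.
by rewrite ceil_ge0 (lt_le_trans _ x0) ?ltrN10.
Qed.

Lemma nat_ceil_lt (x : R) : 0 <= x -> (nat_ceil x)%:R < x + 1.
Proof.
move=> x0; rewrite /nat_ceil pmulrn gez0_abs; last first.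
  by rewrite ceil_ge0 (lt_le_trans _ x0) ?ltrN10.
by have /andP[] := ceil_itv x; rewrite intrB -ltrBlDr.
Qed.

Lemma nat_ceil_gt0 (x : R) : 0 < x -> (0 < nat_ceil x)%N.
Proof.
by move=> x0; rewrite -(ltr_nat R) (lt_le_trans x0) ?nat_ceil_ge ?ltW.
Qed.

(** The ceiling is below [l / 6 + 1], which is less than [l] once [l] is at least 2. Thus
    [l - c - 1] is negative only for [l = c = 1]. *)
Lemma nat_ceil_scale_bounds (lambda : R) l : 0 < lambda -> lambda <= 1 / 6 ->
  (0 < l)%N ->
  (0 < nat_ceil (lambda * l%:R) <= l)%N /\
  ((nat_ceil (lambda * l%:R) < l)%N \/ l = 1%N).
Proof.
move=> lam0 lam1 l0; have l0R : 0 < l%:R :> R by rewrite ltr0n.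
have x0 : 0 < lambda * l%:R by rewrite mulr_gt0.
have lt_c := nat_ceil_lt (ltW x0); have c0 := nat_ceil_gt0 x0.
have xl : lambda * l%:R <= l%:R / 6 by nra.
have cl : (nat_ceil (lambda * l%:R) <= l)%N.
  rewrite -ltnS -(ltr_nat R) -natr1; lra.
split; first by rewrite c0.
have [l1|l2] := leqP l 1; [right; lia|left].
rewrite -(ltr_nat R); have : 2 <= l%:R :> R by rewrite (ler_nat R 2).
lra.
Qed.

Variable r : nat.
Hypothesis r2 : (2 <= r)%N.
Local Notation q := (2 * r%:R - 1 : R).

Lemma r_ge2 : 2 <= r%:R :> R.
Proof. by rewrite (ler_nat R 2). Qed.

Lemma q_gt0 : 0 < q.
Proof. have := r_ge2; lra. Qed.

Lemma natr_pred2 : ((2 * r).-1)%:R = q.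
Proof. by rewrite -subn1 natrB ?natrM //; lia. Qed.

Lemma FR_nat k : (0 < k)%N -> FR R r k = (2 * r * (2 * r).-1 ^ k.-1)%:R.
Proof.
case: k => // k _; rewrite /FR !natrM natrX natr_pred2 /=.
by rewrite (_ : k.+1%:Z - 1 = k) //; lia.
Qed.

Lemma FR0 : FR R r 0 * q = 2 * r%:R.
Proof. by rewrite /FR sub0r exprN1 mulfVK ?gt_eqF ?q_gt0. Qed.

Lemma FR_gt0 k : 0 < FR R r k.
Proof. by rewrite !mulr_gt0 ?exprz_gt0 ?q_gt0 ?ltr0n //; lia. Qed.

Lemma CR_ge k : q ^+ k <= CR R r k.
Proof.
have := r_ge2; rewrite /CR -signr_odd -addrA lerDl; case: odd;
  by rewrite /= ?expr1 ?expr0; nra.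
Qed.

(** The number subtracted is at most [2 * (i + 1) * l], because [(k - 2) * c + l2 + 1] is at most
    [l]; this is at most [2 * m * l]. *)
Lemma alpha_ge0 m l c l1 l2 i k :
    2 * m%:R * l%:R <= FR R r c -> l = (l1 * c + l2)%N -> (0 < c)%N -> (i < m)%N ->
    (1 <= k <= l1)%N ->
  0 <= alpha R r l c l2 i.+1 k.
Proof.
move=> hm hl c0 im /andP[k1 kl1].
have im' : i%:R + 1 <= m%:R :> R by rewrite natr1 ler_nat.
have l0 : 0 <= l%:R :> R by [].
rewrite /alpha; case: eqP => [_|k_neq1].
  by rewrite -[i.+1%:R]natr1 addrK; nra.
have hk : ((k - 2) * c + l2 + 1 <= l)%N.
  have : (k * c <= l1 * c)%N by rewrite leq_mul2r kl1 orbT.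
  rewrite hl mulnBl; nia.
move: hk; rewrite -(ler_nat R) !natrD natrM natrB; last by lia.
by rewrite -[i.+1%:R]natr1 addrK => hk; nra.
Qed.

(** Multiplying the hypothesis by [q ^ (l - c - 1)] bounds the subtracted term by
    [4 * r * (r - 1) * q ^ (l - 2)]. This is at most [q ^ l], as [q ^ 2 = 4 * r * (r - 1) + 1]. *)
Lemma omega_ge0 m l c i :
    2 * m%:R * l%:R <= FR R r c -> (0 < c <= l)%N -> (c < l)%N \/ l = 1%N ->
    (i < m)%N ->
  0 <= omega R r l c i.+1.
Proof.
move=> hm /andP[c0 cl] hcl im.
have im' : i%:R + 1 <= m%:R :> R by rewrite natr1 ler_nat.
have l0 : 0 <= l%:R :> R by [].
have i0 : 0 <= i%:R :> R by [].
have r2' := r_ge2; have q0 := q_gt0.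
rewrite /omega -[i.+1%:R]natr1 addrK.
case: hcl => [lt_cl|l1]; last first.
  have c1 : c = 1%N by lia.
  rewrite l1 c1 in hm *; rewrite subrr sub0r exprN1.
  move: hm; rewrite /FR subrr expr0z !mulr1 => hm.
  have : 4 * i%:R * (r%:R - 1) / q <= 2 * i%:R by rewrite ler_pdivrMr //; nra.
  have := CR_ge 1; rewrite expr1; lra.
have -> : l%:Z - c%:Z - 1 = ((l - c).-1)%:Z by lia.
have {hm}: 2 * m%:R * l%:R * q ^+ (l - c).-1 <= 2 * r%:R * q ^+ (l - 2).
  rewrite (_ : l - 2 = c.-1 + (l - c).-1)%N; last by lia.
  rewrite exprD mulrA ler_pM2r ?exprn_gt0 //; move: hm.
  by rewrite /FR (_ : c%:Z - 1 = c.-1) //; lia.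
have: (4 * i%:R * l%:R * (r%:R - 1)) * q ^+ (l - c).-1
        <= 2 * (r%:R - 1) * (2 * m%:R * l%:R * q ^+ (l - c).-1).
  rewrite [leRHS]mulrA ler_pM2r ?exprn_gt0 //.
  have : 0 <= l%:R * (r%:R - 1) * (m%:R - i%:R) :> R.
    by rewrite !mulr_ge0 //; lra.
  lra.
have := CR_ge l; rewrite -{1}(subnK (_ : 2 <= l)%N); last by lia.
rewrite exprD; have : 0 < q ^+ (l - 2) by rewrite exprn_gt0.
rewrite -exprnP; set Q := q ^+ (l - 2); set A := q ^+ (l - c).-1.
move=> Q0 h1 h2 h3; rewrite subr_ge0 (le_trans h2) // (le_trans _ h1) //.
have : 2 * (r%:R - 1) * (2 * m%:R * l%:R * A) <= 2 * (r%:R - 1) * (2 * r%:R * Q).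
  by rewrite ler_pM2l //; lra.
nra.
Qed.

End Quantities.

(** * Choosing the next relator *)

Section Counting.
Variables (R : realType) (X : finType).
Local Notation letter := (letter X).
Local Notation letters := (enum {: letter}).
Local Notation r := #|X|.
Implicit Types (x y z : letter) (w u v : seq letter) (W : seq (seq letter)).
Hypothesis r2 : (2 <= r)%N.
Variables (l c : nat).
Hypotheses (c_gt0 : (0 < c)%N) (c_le : (c <= l)%N).

Definition relator w := cyclically_reduced w && (size w == l).
(** All that the counting retains of the small cancellation condition; it passes to initial segments
    of the list. *)
Definition separated W := uniq (flatten [seq occurrences c l w | w <- W]).

Lemma separated_occurrence W u : all relator W ->
  u \in flatten [seq occurrences c l w | w <- W] ->
  freely_reduced u && (size u == c).
Proof.
move=> /allP relW /flatten_mapP[w /relW /andP[w_cyc /eqP wl]].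
by apply: freely_reduced_occurrence; rewrite ?wl.
Qed.

Lemma size_flatten_occurrences W :
  size (flatten [seq occurrences c l w | w <- W]) = (2 * (size W * l))%N.
Proof.
elim: W => [|w W IHW] /=; first by rewrite muln0.
by rewrite size_cat IHW size_occurrences mulSn mulnDr.
Qed.

Lemma separated_size W : all relator W -> separated W ->
  2 * (size W)%:R * l%:R <= FR R r c.
Proof.
move=> relW sepW; rewrite FR_nat // -!natrM ler_nat -size_reduced_words -mulnA.
rewrite -size_flatten_occurrences; apply: uniq_leq_size => // u.
by move=> /(separated_occurrence relW) /andP[? /eqP]; apply: mem_reduced_words.
Qed.

(** [W] holds the relators already chosen, [s] the candidates for the next one, and [P] the subwords
    already used. *)
Variables (W : seq (seq letter)) (s : seq (seq letter)).
Hypotheses (relW : all relator W) (s_uniq : uniq s) (s_gt0 : (0 < size s)%N).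
Hypothesis sP : {in s, forall w, relator w /\ separated (rcons W w)}.
Local Notation P := (flatten [seq occurrences c l w | w <- W]).

Lemma separated_rcons w : separated (rcons W w) -> uniq (P ++ occurrences c l w).
Proof. by rewrite /separated map_rcons flatten_rcons. Qed.

Lemma next_relator_omega : (c < l)%N \/ l = 1%N ->
  (size s)%:R <= omega R r l c (size W).+1.
Proof.
move=> hcl.
have hs : {in s, forall w, [/\ cyclically_reduced w, size w = l
    & uniq (P ++ occurrences c l w)]}.
  by move=> w /sP[/andP[w_cyc /eqP wl] /separated_rcons].
have P_uniq : uniq P.
  have : nth [::] s 0 \in s by rewrite mem_nth.
  by move=> /hs[_ _]; rewrite cat_uniq => /andP[].
have bound B := size_occurrence_prefixes_le (B := B) s_uniq c_le c_gt0 hs P_uniq.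
rewrite size_flatten_occurrences in bound.
rewrite /omega -[(size W).+1%:R]natr1 addrK -(count_cyclic R) //; try lia.
case: hcl => [lt_cl|l1].
  have {bound} := bound ((2 * r - 2) * (2 * r).-1 ^ (l - c).-1)%N.
  have hB : {in P, forall p, (2 * r - 2) * (2 * r).-1 ^ (l - c).-1 <=
      count (fun w => cycle (@follows X) w && (take c w == p)) (words letters l)}%N.
    move=> p /(separated_occurrence relW) /andP[p_red /eqP pc].
    by apply: count_prefix_ge => //; rewrite c_gt0.
  move=> /(_ hB); rewrite -(ler_nat R) natrD !natrM natrX natrB; last by lia.
  rewrite natrM natr_pred2 //.
  have -> : l%:Z - c%:Z - 1 = ((l - c).-1)%:Z by lia.
  by rewrite -exprnP; lra.
(* A prefix is now the whole word, so [B = 1], and 1 is at least the factor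
   [2 * (r - 1) / (2 * r - 1)] that [omega] has here. *)
have c1 : c = 1%N by lia.
have {bound} := bound 1%N.
have hB : {in P, forall p, 1 <=
    count (fun w => cycle (@follows X) w && (take c w == p)) (words letters l)}%N.
  move=> p /(separated_occurrence relW) /andP[_ /eqP pc].
  rewrite -has_count; apply/hasP; exists p; last first.
    rewrite -pc take_size eqxx andbT.
    by move: pc; rewrite c1; case: p => [|x []] //= _; rewrite /follows linv_neq.
  by rewrite mem_words pc c1 l1 eqxx; apply/allP => x _; rewrite /= mem_enum.
move=> /(_ hB); rewrite -(ler_nat R) natrD !natrM l1 c1 subrr sub0r exprN1 !mulr1.
have : 4 * (size W)%:R * (r%:R - 1) / (2 * r%:R - 1) <= 2 * (size W)%:R :> R.
  have := r_ge2 R r2; have w0 : 0 <= (size W)%:R :> R by [].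
  by move=> r2'; rewrite ler_pdivrMr ?q_gt0 //; nra.
lra.
Qed.

Variables l1 l2 : nat.
Hypotheses (l_div : l = (l1 * c + l2)%N) (l2_lt : (l2 < c)%N).

Lemma block_end k : (k < l1)%N -> (l2 + k * c + c <= l)%N.
Proof.
move=> kl1; have : (k.+1 * c <= l1 * c)%N by rewrite leq_mul2r kl1 orbT.
by rewrite l_div mulSn; lia.
Qed.

Lemma block_fiber_alpha k w : (k < l1)%N -> w \in s ->
  let a := (l2 + k * c)%N in
  let F := size (undup [seq take c (drop a u) | u <- s & take a u == take a w]) in
  F%:R <= alpha R r l c l2 (size W).+1 k.+1 /\ F%:R <= FR R r c.
Proof.
move=> kl1 ws a; have ac : (a + c <= l)%N := block_end kl1.
(* The number of positions at which a subword of length [c] fits into the prefix of length [a]: none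
   for [k = 0], since [l2 < c], and [a - c + 1] otherwise. *)
pose n := if k is k'.+1 then (l2 + k' * c).+1 else 0%N.
have wl : size w = l by have [/andP[_ /eqP]] := sP ws.
have va : size (take a w) = a by rewrite size_takel // wl; lia.
set s' := [seq u <- s | take a u == take a w].
have hn d : (d < n)%N -> (d + c <= size (take a w))%N.
  by rewrite va /n /a; case: (k) => // k' dn; rewrite mulSn; lia.
have s'_gt0 : (0 < size s')%N.
  have : w \in s' by rewrite mem_filter eqxx.
  by case: s'.
have hP : {in P, forall u, freely_reduced u && (size u == c)}.
  by move=> u /(separated_occurrence relW).
have hs' : {in s', forall u, [/\ cyclically_reduced u,
    (size (take a w) + c <= size u)%N, take (size (take a w)) u = take a w
    & uniq (P ++ occurrences c (size u) u)]}.
  move=> u; rewrite mem_filter => /andP[/eqP uw us].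
  by have [/andP[u_cyc /eqP ul] /separated_rcons] := sP us; rewrite va ul.
have := size_next_block_le c_gt0 hn s'_gt0 hP hs'.
rewrite va size_flatten_occurrences; set F := undup _ => Fle.
have {}Fle : (size F)%:R + (2 * ((size W)%:R * l%:R) + 2 * n%:R) <= FR R r c.
  by rewrite FR_nat // -!natrM -!natrD ler_nat.
have W0 : 0 <= (size W)%:R * l%:R :> R by rewrite mulr_ge0.
have n0 : 0 <= n%:R :> R by [].
split; last by lra.
rewrite /alpha eqSS -[(size W).+1%:R]natr1 addrK.
case: (k) @n {hn} Fle n0 => [|k'] /= Fle n0; first by lra.
move: Fle; rewrite -[(l2 + _).+1%:R]natr1 natrD natrM -[k'.+2%:R]natr1 -[k'.+1%:R]natr1.
lra.
Qed.

(** A nonempty prefix has a last letter, after which each letter of the block has [2 * r - 1]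
    choices. *)
Lemma block_fiber_path k w : (k < l1)%N -> w \in s ->
  let a := (l2 + k * c)%N in (0 < a)%N ->
  (size (undup [seq take c (drop a u) | u <- s & take a u == take a w]))%:R
    <= (2 * r%:R - 1) ^+ c :> R.
Proof.
move=> kl1 ws a a0; have ac : (a + c <= l)%N := block_end kl1.
have wl : size w = l by have [/andP[_ /eqP]] := sP ws.
have : size (take a w) = a by rewrite size_takel // wl; lia.
case: (take a w) => [|y v] va; first by rewrite -va in a0.
rewrite -natr_pred2 // -natrX ler_nat.
apply: (@size_path_le _ (last y v)); first exact: undup_uniq.
move=> t; rewrite mem_undup => /mapP[u].
rewrite mem_filter => /andP[/eqP uv us] ->.
have [/andP[u_cyc /eqP ul] _] := sP us.
rewrite size_takel ?size_drop ?ul ?eqxx ?andbT; last by lia.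
have : freely_reduced (take (a + c) u).
  by rewrite freely_reduced_take // -[u]rot0 freely_reduced_rot.
by rewrite takeD uv freely_reducedE /= cat_path => /andP[].
Qed.

(** [N k] counts the prefixes of length [l2 + k * c], and each block multiplies the bound by
    [B k.+1]. The hypothesis keeps these factors nonnegative, so the inequalities can be
    multiplied. *)
Lemma next_relator_blocks : 2 * (size W).+1%:R * l%:R <= FR R r c ->
  (size s)%:R <= beta R r l2 *
     \prod_(1 <= k < l1.+1)
        Num.min ((2 * r%:R - 1) ^+ c) (alpha R r l c l2 (size W).+1 k).
Proof.
move=> hFR.
pose N k := (size (undup [seq take (l2 + k * c) u | u <- s]))%:R : R.
pose B k := Num.min ((2 * r%:R - 1) ^+ c) (alpha R r l c l2 (size W).+1 k).
have B_ge0 k : (k < l1)%N -> 0 <= B k.+1.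
  move=> kl1; rewrite le_min exprn_ge0 ?(alpha_ge0 _ hFR l_div) //.
  by have := q_gt0 R r2; apply: ltW.
have extend k C : {in s, forall w, (size (undup
       [seq take c (drop (l2 + k * c) u)
          | u <- s & take (l2 + k * c) u == take (l2 + k * c) w]))%:R <= C} ->
   N k.+1 <= N k * C.
  move=> hC; apply: size_undup_extend hC => u v _ _ uv1 uv2.
  by rewrite mulSn addnCA addnC takeD uv1 uv2 -takeD.
have l1_gt0 : (0 < l1)%N by case: (l1) l_div => //; lia.
have N1 : N 1%N <= beta R r l2 * B 1%N.
  have [l20|l2_gt0] := posnP l2.
    (* FR R r 0 = 2r / (2r - 1) turns the (2r - 1)^c continuations of a block
       into all the FR R r c possible first blocks. *)
    have hN1 : N 1%N <= N 0%N * Num.min (FR R r c) (alpha R r l c l2 (size W).+1 1).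
      apply: extend => w ws.
      by have [Fa Ff] := block_fiber_alpha l1_gt0 ws; rewrite le_min Fa Ff.
    have hN0 : N 0%N <= 1.
      rewrite (ler_nat R _ 1); apply: (@uniq_leq_size _ _ [:: [::]] (undup_uniq _)).
      by move=> t; rewrite mem_undup => /mapP[u _ ->]; rewrite l20 take0 mem_head.
    have q0 := q_gt0 R r2; have r2' := r_ge2 R r2.
    have beta_ge1 : 1 <= beta R r l2.
      by rewrite /beta l20 -(ler_pM2r q0) FR0 //; lra.
    have FRE : FR R r c = beta R r l2 * (2 * r%:R - 1) ^+ c.
      rewrite /beta l20 -(prednK c_gt0) exprS mulrA FR0 //.
      by rewrite FR_nat // natrM natrX natr_pred2 // natrM.
    have a0 : 0 <= alpha R r l c l2 (size W).+1 1 by apply: (alpha_ge0 _ hFR l_div).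
    have FR0' := FR_gt0 R r2 c.
    have min0 : 0 <= Num.min (FR R r c) (alpha R r l c l2 (size W).+1 1).
      by rewrite le_min a0 ltW.
    apply: le_trans hN1 (le_trans (ler_wpM2r min0 hN0) _).
    (* Since [beta] is at least 1, moving it into the minimum turns the first entry into [FR R r c]
       and does not decrease the second. *)
    rewrite mul1r /B minr_pMr ?(le_trans ler01) // -FRE le_min !ge_min lexx /=.
    by rewrite (ler_peMl a0 beta_ge1) orbT.
  apply: (le_trans (extend 0%N (B 1%N) _)).
    move=> w ws; rewrite le_min block_fiber_path ?addn_gt0 ?l2_gt0 //.
    by have [] := block_fiber_alpha l1_gt0 ws.
  rewrite ler_wpM2r ?B_ge0 // /beta FR_nat // ler_nat -size_reduced_words.
  apply: uniq_leq_size (undup_uniq _) _ => t; rewrite mem_undup => /mapP[u us ->].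
  have [/andP[u_cyc /eqP ul] _] := sP us.
  rewrite mul0n addn0 mem_reduced_words ?freely_reduced_take //.
    by rewrite -[u]rot0 freely_reduced_rot.
  by rewrite size_takel // ul; lia.
have Nk k : (k < l1)%N -> N k.+1 <= beta R r l2 * \prod_(1 <= j < k.+2) B j.
  elim: k => [|k IHk] kl1; first by rewrite big_nat1.
  rewrite big_nat_recr //= mulrA.
  apply: le_trans (ler_wpM2r (B_ge0 _ kl1) (IHk (ltnW kl1))).
  apply: extend => w ws; rewrite le_min block_fiber_path //; last by lia.
  by have [] := block_fiber_alpha kl1 ws.
suff <- : N l1 = (size s)%:R by have := Nk l1.-1; rewrite prednK // => ->.
rewrite /N addnC -l_div map_id_in ?undup_id // => u us.
by have [/andP[_ /eqP ul] _] := sP us; rewrite take_oversize // ul.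
Qed.

End Counting.

(** * Choosing all relators *)

Definition tval_all (T : Type) l m (W : m.-tuple (l.-tuple T)) : seq (seq T) :=
  [seq tval w | w <- W].

Lemma tval_all_inj (T : Type) l m : injective (@tval_all T l m).
Proof. by move=> W V /(inj_map val_inj) /val_inj. Qed.

Lemma tval_all_onto (T : Type) l m (s : seq (seq T)) :
    size s = m -> all (fun w => size w == l) s ->
  exists W : m.-tuple (l.-tuple T), tval_all W = s.
Proof.
move=> sm sl; pose W : seq (l.-tuple T) := pmap insub s.
have WE : map val W = s.
  rewrite (pmap_filter (insubK _)); apply/all_filterP.
  by apply: sub_all sl => w wl; rewrite /= insubT.
have Wm : size W == m by rewrite -(size_map val) WE sm.
by exists (Tuple Wm).
Qed.

Section Presentations.
Variables (R : realType) (X : finType).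
Local Notation letters := (enum {: letter X}).

Lemma card_presentations l m : (0 < #|X|)%N -> (0 < l)%N ->
  #|presentations X l m|%:R = CR R #|X| l ^+ m.
Proof.
move=> X0 l0; rewrite -(count_cyclic R) // -natrX -size_filter -size_words.
rewrite cardE -(size_map (@tval_all _ l m)).
congr _%:R; apply/perm_size/uniq_perm.
- by rewrite (map_inj_uniq (@tval_all_inj _ l m)) enum_uniq.
- by rewrite uniq_words // filter_uniq // uniq_words ?enum_uniq.
move=> s; rewrite mem_words; apply/mapP/andP => [[W]|[/eqP sm /allP hs]].
  rewrite mem_enum inE => /allP hW ->; rewrite size_map size_tuple eqxx.
  split=> //; apply/allP => _ /mapP[w wW ->].
  rewrite /= mem_filter -cyclically_reducedE hW // mem_words size_tuple eqxx.
  by apply/allP => x _; rewrite /= mem_enum.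
have hs' w : w \in s -> cyclically_reduced w && (size w == l).
  by move=> /hs; rewrite /= mem_filter mem_words -cyclically_reducedE => /and3P[-> ->].
have [|W WE] := @tval_all_onto (letter X) l m s sm.
  by apply/allP => w /hs' /andP[].
exists W => //; rewrite mem_enum inE; apply/allP => w wW.
by have /andP[] : relator l (tval w) by apply: hs'; rewrite -WE map_f.
Qed.

Variables (l m c l1 l2 : nat).
Local Notation r := #|X|.
Hypotheses (r2 : (2 <= r)%N) (c_gt0 : (0 < c)%N) (c_le : (c <= l)%N).
Hypothesis hcl : (c < l)%N \/ l = 1%N.
Hypotheses (l_div : l = (l1 * c + l2)%N) (l2_lt : (l2 < c)%N).
Hypothesis hFR : 2 * m%:R * l%:R <= FR R r c.

Local Notation B i := (Num.min (omega R r l c i)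
            (beta R r l2 *
             \prod_(1 <= k < l1.+1)
                Num.min ((2 * r%:R - 1) ^+ c) (alpha R r l c l2 i k))).

Lemma relator_bound_ge0 i : (i < m)%N -> 0 <= B i.+1.
Proof.
move=> im; rewrite le_min (omega_ge0 r2 hFR) ?c_gt0 //=.
rewrite mulr_ge0 //; first exact: ltW (FR_gt0 _ r2 _).
rewrite big_nat prodr_ge0 // => k hk.
rewrite le_min (alpha_ge0 r2 hFR l_div) // andbT exprn_ge0 // ltW //.
exact: q_gt0 r2.
Qed.

(** The same scheme one level up: [N i] counts the lists of the first [i] relators, and the fibre
    over such a list consists of candidates for the next relator. *)
Lemma size_separated_le (G : seq (seq (seq (letter X)))) : uniq G ->
    {in G, forall W, [/\ size W = m, all (relator l) W & separated l c W]} ->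
  (size G)%:R <= \prod_(1 <= i < m.+1) B i.
Proof.
move=> G_uniq hG; pose N i := (size (undup [seq take i W | W <- G]))%:R : R.
have NE : N m = (size G)%:R.
  rewrite /N map_id_in ?undup_id // => W /hG[Wm _ _].
  by rewrite take_oversize // Wm.
have Ni i : (i <= m)%N -> N i <= \prod_(1 <= j < i.+1) B j.
  elim: i => [|i IHi] im.
    rewrite big_geq // (ler_nat R _ 1).
    apply: (@uniq_leq_size _ _ [:: [::]] (undup_uniq _)) => t.
    by rewrite mem_undup => /mapP[W _ ->]; rewrite take0 mem_head.
  rewrite big_nat_recr //=.
  apply: le_trans (ler_wpM2r (relator_bound_ge0 im) (IHi (ltnW im))).
  apply: (@size_undup_extend _ _ _ _ _ _ _ (nth [::] ^~ i)) => [U V|W WG].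
    move=> /hG[Um _ _] /hG[Vm _ _].
    by rewrite !(take_nth [::]) ?Um ?Vm // => -> ->.
  set s := undup _.
  have [Wm relW sepW] := hG W WG.
  have tW : size (take i W) = i by rewrite size_takel // Wm ltnW.
  have rel_t : all (relator l) (take i W).
    by apply/allP => w /mem_take; apply: (allP relW).
  have s_gt0 : (0 < size s)%N.
    have : nth [::] W i \in s.
      by rewrite mem_undup; apply/mapP; exists W; rewrite ?mem_filter ?eqxx.
    by case: s.
  have sP : {in s, forall w, relator l w /\ separated l c (rcons (take i W) w)}.
    move=> w; rewrite mem_undup => /mapP[V].
    rewrite mem_filter => /andP[/eqP <- /hG[Vm relV sepV]] ->; split.
      by apply: (allP relV); rewrite mem_nth ?Vm.
    (* The occurrences in the first [i + 1] relators of [V] form an initial segment of the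
       repetition-free list for [V]. *)
    rewrite -take_nth ?Vm //; move: sepV.
    rewrite /separated -{1}(cat_take_drop i.+1 V) map_cat flatten_cat cat_uniq.
    by case/andP.
  have hFRi : 2 * (size (take i W)).+1%:R * l%:R <= FR R r c.
    by apply: le_trans hFR; rewrite tW ler_wpM2r // ler_wpM2l // ler_nat.
  rewrite le_min -{1}tW -{2}tW.
  have s_uniq : uniq s := undup_uniq _.
  rewrite (next_relator_omega R r2 c_gt0 c_le rel_t s_uniq s_gt0 sP hcl) /=.
  by apply: (next_relator_blocks _ _ _ _ _ _ sP _ _ hFRi).
by rewrite -NE; apply: Ni.
Qed.

End Presentations.

Theorem proposition3p5 (R : realType) (lambda : R) (X : finType)
    (r l m c l1 l2 : nat)
    (hlambda0 : 0 < lambda) (hlambda1 : lambda <= 1 / 6)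
    (hX : #|X| = r) (hr : (2 <= r)%N) (hl : (1 <= l)%N) (hm : (1 <= m)%N)
    (hc : c = nat_ceil (lambda * l%:R))
    (hdiv : l = (l1 * c + l2)%N) (hl2 : (l2 < c)%N) :
  (FR R r c < 2 * m%:R * l%:R ->
     prob_small_cancellation X lambda l m = 0) /\
  (~ (FR R r c < 2 * m%:R * l%:R) ->
     prob_small_cancellation X lambda l m <=
       1 / CR R r l ^+ m *
       \prod_(1 <= i < m.+1)
          Num.min (omega R r l c i)
            (beta R r l2 *
             \prod_(1 <= k < l1.+1)
                Num.min ((2 * r%:R - 1) ^+ c) (alpha R r l c l2 i k))).
Proof.
have [/andP[c_gt0 c_le] hcl] := nat_ceil_scale_bounds hlambda0 hlambda1 hl.
rewrite -hc in c_gt0 c_le hcl.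
have lam_c : lambda * l%:R <= c%:R.
  by rewrite hc nat_ceil_ge // mulr_ge0 // ltW.
subst r; rewrite /prob_small_cancellation.
set good := [set W in _ | _].
have goodP W : W \in good -> [/\ size (tval_all W) = m,
    all (relator l) (tval_all W) & separated l c (tval_all W)].
  rewrite !inE => /andP[/allP W_cyc /asboolP W_sc].
  have relW : all (relator l) (tval_all W).
    by apply/allP => _ /mapP[w wW ->]; rewrite /relator W_cyc //= size_tuple.
  rewrite size_map size_tuple; split=> //.
  exact: (small_cancellation_uniq hl c_le lam_c (allP relW) W_sc).
split=> [FR_lt|/negP].
  have -> : good = set0.
    apply/setP => W; rewrite [RHS]inE; apply/negP => /goodP[Wm relW sepW].
    by have := separated_size R hr c_gt0 c_le relW sepW; rewrite Wm leNgt FR_lt.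
  by rewrite cards0 mul0r.
rewrite -leNgt => hFR; rewrite card_presentations //; last by lia.
rewrite div1r mulrC ler_wpM2l //.
  (* [CR] is nonnegative because it is a cardinality. *)
  by rewrite invr_ge0 exprn_ge0 // -(count_cyclic R) //; lia.
rewrite cardE -(size_map (@tval_all _ l m)).
apply: (size_separated_le hr c_gt0 c_le hcl hdiv hl2 hFR).
  by rewrite (map_inj_uniq (@tval_all_inj _ l m)) enum_uniq.
by move=> _ /mapP[W + ->]; rewrite mem_enum => /goodP.
Qed.
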